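(* For each $\nu\in\{1,2\}$, the sets $\mathscr{U}_{x,y}^\nu$ and $\mathscr{T}_{x,y}^\nu$ both form commutative semirings under the operations of addition and multiplication of formal Laurent series.
   Context: For $\nu\in\{1,2\}$, $\mathscr{U}_x^\nu$ denotes the set of Laurent polynomials $f(x)=\sum_{i\in\mathbb{Z}}c_ix^i$ with real coefficients $c_i\ge 0$ such that $c_{-i}=c_i$ for all integers $i$, and for every integer $r$ with $0\le r<\nu$ and every integer $\ell\ge 0$ one has $c_{r+\ell\nu}\ge c_{r+(\ell+1)\nu}$. $\mathscr{T}_x^\nu$ denotes the set of $f\in\mathscr{U}_x^\nu$ which moreover satisfy $c_{r+\ell\nu}>c_{r+(\ell+1)\nu}$ whenever $c_{r+\ell\nu}>0$ (for $0\le r<\nu$, $\ell\ge 0$). Consider formal series $F(x,y)=\sum_{j\in\mathbb{Z}}C_j(x)y^j$ in $y$ (with only finitely many nonzero $C_j$ for $j<0$) whose coefficients $C_j(x)$ are Laurent polynomials in $x$ with real coefficients. Such $F$ belongs to $\mathscr{U}_{x,y}^\nu$ (resp. $\mathscr{T}_{x,y}^\nu$) if $C_j(x)\in\mathscr{U}_x^\nu$ (resp. $C_j(x)\in\mathscr{T}_x^\nu$) for every $j\in\mathbb{Z}$. *)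

(* Defs.v *)
From HB Require Import structures.
From mathcomp Require Import all_boot all_order all_algebra.
From mathcomp Require Import boolp classical_sets functions cardinality fsbigop.
From mathcomp Require Import reals.
From mathcomp Require Import zify.

Set Implicit Arguments.
Unset Strict Implicit.
Unset Printing Implicit Defensive.
Import Order.TTheory GRing.Theory Num.Theory.
Local Open Scope classical_set_scope.
Local Open Scope ring_scope.

(* Formal Laurent series sum_j (lcoef j) y^j over K. *)
Record lseries (K : comNzRingType) := LSeries {
  lcoef :> int -> K ;
  lcoef_fin : finite_set [set j : int | j < 0 /\ lcoef j != 0] }.

HB.instance Definition _ (K : comNzRingType) := gen_eqMixin (lseries K).
HB.instance Definition _ (K : comNzRingType) := gen_choiceMixin (lseries K).

Section LaurentSeriesRing.
Variable K : comNzRingType.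
Implicit Types (f g h : int -> K) (F G H : lseries K).

Lemma lseriesP F G : (forall j, F j = G j) -> F = G.
Proof.
case: F G => [f hf] [g hg] /= fg; have {}fg : f = g by apply/funext.
by case: _ / fg in hg *; congr LSeries; exact: Prop_irrelevance.
Qed.

Definition vanish_below f (N : nat) := forall j : int, j < - N%:Z -> f j = 0.

Lemma vanish_belowP f :
  finite_set [set j : int | j < 0 /\ f j != 0] <-> exists N, vanish_below f N.
Proof.
split=> [/finite_seqP[s sE]|[N fN]].
  exists (\sum_(i <- s) `|i|)%N => j jlt; apply/eqP/negPn/negP => fj.
  have : [set j : int | j < 0 /\ f j != 0] j by split=> //; lia.
  rewrite sE /= => js.
  have : (`|j| <= \sum_(i <- s) `|i|)%N by rewrite (big_rem j) //= leq_addr.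
  by move=> ?; lia.
apply: (@sub_finite_set _ _ ((fun k : nat => - k%:Z) @` `I_N.+1)); last first.
  exact/finite_image/finite_II.
move=> j [jlt0 fj]; exists `|j|%N => /=; last by lia.
by case: (ltP j (- N%:Z)) => [/fN f0|]; [rewrite f0 eqxx in fj|lia].
Qed.

Lemma lseries_below F : exists N, vanish_below F N.
Proof. exact/vanish_belowP/lcoef_fin. Qed.

Lemma vanish_below_le f (M N : nat) :
  (M <= N)%N -> vanish_below f M -> vanish_below f N.
Proof. by move=> MN fM j jN; apply: fM; lia. Qed.

Definition window (M : nat) : seq int :=
  [seq k%:Z - M%:Z | k <- iota 0 (M + M).+1].

Lemma mem_window M (j : int) : (j \in window M) = (- M%:Z <= j <= M%:Z).
Proof.
apply/mapP/idP => [[k]|jM]; first by rewrite mem_iota => ? ->; lia.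
by exists `|(j + M%:Z)%R|%N; rewrite ?mem_iota; lia.
Qed.

Lemma window_uniq M : uniq (window M).
Proof. by rewrite map_inj_uniq ?iota_uniq // => i j; lia. Qed.

Lemma fsum_window f M : (forall j : int, ~~ (- M%:Z <= j <= M%:Z) -> f j = 0) ->
  \sum_(j \in [set: int]) f j = \sum_(j <- window M) f j.
Proof.
move=> f0; rewrite (fsbigE (window M)) ?window_uniq //.
  by apply: eq_bigl => j; rewrite in_setT.
by move=> j _; rewrite mem_window; exact: f0.
Qed.

(* A sum over [set: int] is 0 when infinitely many terms are nonzero; this
   never happens for the Laurent series below (see lconv_window). *)
Definition lconv f g (n : int) : K :=
  \sum_(k \in [set: int]) f k * g (n - k).

Lemma lconv_window f g N M (n : int) :
    vanish_below f N -> vanish_below g N -> n + N%:Z <= M%:Z -> (N <= M)%N ->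
  lconv f g n = \sum_(k <- window M) f k * g (n - k).
Proof.
move=> fN gN nM NM; apply: fsum_window => k kM.
have [/fN->|] := ltP k (- N%:Z); first by rewrite mul0r.
by move=> kN; rewrite gN ?mulr0 //; lia.
Qed.

Lemma lconv_below f g N :
  vanish_below f N -> vanish_below g N -> vanish_below (lconv f g) (N + N).
Proof.
move=> fN gN n nlt; apply: fsbig1 => k _.
have [/fN->|] := ltP k (- N%:Z); first by rewrite mul0r.
by move=> kN; rewrite gN ?mulr0 //; lia.
Qed.

Lemma lconvC f g : lconv f g =1 lconv g f.
Proof.
move=> n; rewrite /lconv (@reindex_fsbig _ _ _ _ _ (fun k => n - k) setT) /=.
  by apply: eq_fsbigr => k _; rewrite subKr mulrC.
split=> // [i j _ _|j _]; first by move=> ?; lia.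
by exists (n - j) => //; rewrite subKr.
Qed.

Lemma lconvA f g h N :
    vanish_below f N -> vanish_below g N -> vanish_below h N ->
  lconv f (lconv g h) =1 lconv (lconv f g) h.
Proof.
move=> fN gN hN n; have fgN := lconv_below fN gN; have ghN := lconv_below gN hN.
have leN : (N <= N + N)%N by exact: leq_addr.
set M := (`|n| + N + N + N)%N.
rewrite (@lconv_window f _ (N + N) M) //; try lia;
  last exact: vanish_below_le fN.
rewrite (@lconv_window _ h (N + N) M) //; try lia;
  last exact: vanish_below_le hN.
have fgE m : m \in window M -> lconv f g m * h (n - m) =
    \sum_(k <- window M) f k * (g (m - k) * h (n - m)).
  rewrite mem_window => mM.
  have [/hN->|nm] := ltP (n - m) (- N%:Z).
    by rewrite mulr0 big1 // => k _; rewrite !mulr0.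
  rewrite (@lconv_window f g N M) //; try lia.
  by rewrite mulr_suml; apply: eq_bigr => k _; rewrite mulrA.
rewrite [RHS]big_seq (eq_bigr _ fgE) -big_seq exchange_big /=.
apply: eq_bigr => k _; rewrite -mulr_sumr.
have [/fN->|kN] := ltP k (- N%:Z); first by rewrite !mul0r.
congr (_ * _); rewrite -fsum_window => [|m mM]; last first.
  have [/gN->|] := ltP (m - k) (- N%:Z); first by rewrite mul0r.
  by move=> mk; rewrite hN ?mulr0 //; lia.
rewrite /lconv [RHS](@reindex_fsbig _ _ _ _ _ (fun l => l + k) setT) /=.
  by apply: eq_fsbigr => l _; rewrite addrK opprD addrA addrAC.
split=> // [i j _ _|j _]; first by move=> ?; lia.
by exists (j - k) => //; rewrite subrK.
Qed.

Lemma fsum_delta f (a : int) :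
  (forall j, j != a -> f j = 0) -> \sum_(j \in [set: int]) f j = f a.
Proof.
move=> f0; rewrite (@fsum_window _ `|a|%N) => [|j ja]; last first.
  by apply: f0; apply: contraNN ja => /eqP ->; lia.
rewrite (bigD1_seq a) ?window_uniq ?mem_window //=; last by lia.
by rewrite big1 ?addr0.
Qed.

Lemma lseries0_fin : finite_set [set j : int | j < 0 /\ (0 : K) != 0].
Proof. by apply/(vanish_belowP (fun=> 0)); exists 0%N. Qed.

Definition lseries0 := LSeries lseries0_fin.

Lemma lseriesC_fin (c : K) :
  finite_set [set j : int | j < 0 /\ (if j == 0 then c else 0) != 0].
Proof.
apply/(vanish_belowP (fun j => if j == 0 then c else 0)).
by exists 0%N => j; case: eqP => // ->; lia.
Qed.

(* The constant series c; lseriesC 1 is the unit. *)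
Definition lseriesC c := LSeries (lseriesC_fin c).

Lemma lseries_opp_fin F : finite_set [set j : int | j < 0 /\ - F j != 0].
Proof.
apply/(vanish_belowP (fun j => - F j)); have [N FN] := lseries_below F.
by exists N => j /FN ->; rewrite oppr0.
Qed.

Definition lseries_opp F := LSeries (lseries_opp_fin F).

Lemma lseries_below2 F G : exists N, vanish_below F N /\ vanish_below G N.
Proof.
have [M FM] := lseries_below F; have [N GN] := lseries_below G.
exists (M + N)%N; split; first exact: vanish_below_le (leq_addr _ _) FM.
exact: vanish_below_le (leq_addl _ _) GN.
Qed.

Lemma lseries_add_fin F G : finite_set [set j : int | j < 0 /\ F j + G j != 0].
Proof.
apply/(vanish_belowP (fun j => F j + G j)).
have [N [FN GN]] := lseries_below2 F G.
by exists N => j jN; rewrite FN ?GN ?addr0.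
Qed.

Definition lseries_add F G := LSeries (lseries_add_fin F G).

Lemma lseries_mul_fin F G : finite_set [set j : int | j < 0 /\ lconv F G j != 0].
Proof.
apply/vanish_belowP; have [N [FN GN]] := lseries_below2 F G.
by exists (N + N)%N; exact: lconv_below.
Qed.

Definition lseries_mul F G := LSeries (lseries_mul_fin F G).

Fact lseries_addA : associative lseries_add.
Proof. by move=> F G H; apply/lseriesP => j /=; rewrite addrA. Qed.
Fact lseries_addC : commutative lseries_add.
Proof. by move=> F G; apply/lseriesP => j /=; rewrite addrC. Qed.
Fact lseries_add0 : left_id lseries0 lseries_add.
Proof. by move=> F; apply/lseriesP => j /=; rewrite add0r. Qed.
Fact lseries_addN : left_inverse lseries0 lseries_opp lseries_add.
Proof. by move=> F; apply/lseriesP => j /=; rewrite addNr. Qed.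

HB.instance Definition _ := GRing.isZmodule.Build (lseries K)
  lseries_addA lseries_addC lseries_add0 lseries_addN.

Fact lseries_mulA : associative lseries_mul.
Proof.
move=> F G H; apply/lseriesP => j /=.
have [M [FM GM]] := lseries_below2 F G; have [N HN] := lseries_below H.
apply: (@lconvA _ _ _ (M + N)%N).
- exact: vanish_below_le (leq_addr _ _) FM.
- exact: vanish_below_le (leq_addr _ _) GM.
- exact: vanish_below_le (leq_addl _ _) HN.
Qed.
Fact lseries_mulC : commutative lseries_mul.
Proof. by move=> F G; apply/lseriesP => j; exact: lconvC. Qed.
Fact lseries_mul1 : left_id (lseriesC 1) lseries_mul.
Proof.
move=> F; apply/lseriesP => j /=; rewrite /lconv (@fsum_delta _ 0) /=.
  by rewrite mul1r subr0.
by move=> k /negPf->; rewrite mul0r.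
Qed.
Fact lseries_mulDl : left_distributive lseries_mul lseries_add.
Proof.
move=> F G H; apply/lseriesP => j /=.
have [M [FM GM]] := lseries_below2 F G; have [N HN] := lseries_below H.
have {}FM := vanish_below_le (leq_addr N _) FM.
have {}GM := vanish_below_le (leq_addr N _) GM.
have {}HN := vanish_below_le (leq_addl M _) HN.
have SM : vanish_below (lseries_add F G) (M + N).
  by move=> k kM /=; rewrite FM ?GM ?addr0.
rewrite !(@lconv_window _ _ (M + N) (`|j| + M + N)) //; try lia.
by rewrite -big_split; apply: eq_bigr => k _; rewrite mulrDl.
Qed.
Fact lseries_one_neq0 : lseriesC 1 != 0.
Proof.
apply/eqP => /(congr1 (fun F : lseries K => F 0)) /= /eqP.
by rewrite oner_eq0.
Qed.

HB.instance Definition _ := GRing.Zmodule_isComNzRing.Build (lseries K)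
  lseries_mulA lseries_mulC lseries_mul1 lseries_mulDl lseries_one_neq0.

Lemma lcoefD F G j : (F + G) j = F j + G j. Proof. by []. Qed.

Lemma lcoefM F G n : (F * G) n = \sum_(k \in [set: int]) F k * G (n - k).
Proof. by []. Qed.

Lemma lcoef0 j : (0 : lseries K) j = 0. Proof. by []. Qed.

Lemma lcoef1 j : (1 : lseries K) j = (j == 0)%:R.
Proof. by rewrite /= ; case: eqP. Qed.

Definition fin_support : {pred lseries K} :=
  fun F => `[< finite_set [set i : int | F i != 0] >].

Fact fin_support_subring : GRing.subring_closed fin_support.
Proof.
split=> [|F G|F G].
- apply/asboolP; apply: (sub_finite_set _ (finite_set1 (0 : int))) => j.
  by rewrite /mkset lcoef1; have [->|_] := eqVneq j 0; rewrite ?eqxx.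
- move=> /asboolP hF /asboolP hG; apply/asboolP.
  have hFG : finite_set ([set i : int | F i != 0] `|` [set i : int | G i != 0]).
    by rewrite finite_setU.
  apply: sub_finite_set hFG => j /=.
  have [-> G0|? _] := eqVneq (F j) 0; last by left.
  by right; apply: contraNN G0 => /eqP ->; rewrite subr0.
- move=> /asboolP hF /asboolP hG; apply/asboolP.
  apply: sub_finite_set (finite_image2 (fun i j => i + j) hF hG) => n /= FG.
  have [k Fk Gk] : exists2 k, F k != 0 & G (n - k) != 0.
    apply: contrapT => nk; case/eqP: FG; apply: fsbig1 => k _.
    have [->|Fk] := eqVneq (F k) 0; first by rewrite mul0r.
    have [->|Gk] := eqVneq (G (n - k)) 0; first by rewrite mulr0.
    by case: nk; exists k.
  by exists k => //; exists (n - k) => //; rewrite addrCA subrr addr0.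
Qed.

HB.instance Definition _ :=
  GRing.isSubringClosed.Build (lseries K) fin_support fin_support_subring.

(* Laurent polynomials are the subring of the Laurent series with finite
   support, so their ring operations are those of lseries K. *)
Record lpoly := LPoly { lpoly_val : lseries K ; _ : lpoly_val \in fin_support }.

HB.instance Definition _ := [isSub for lpoly_val].
HB.instance Definition _ := [Choice of lpoly by <:].
HB.instance Definition _ := [SubChoice_isSubComNzRing of lpoly by <:].

Definition pcoef (p : lpoly) (i : int) : K := lcoef (val p) i.

End LaurentSeriesRing.

Coercion pcoef : lpoly >-> Funclass.

(* unimodal1 and unimodal2 are the paper's U_x^nu and U_{x,y}^nu;
   strict_unimodal1 and strict_unimodal2 are T_x^nu and T_{x,y}^nu. *)
Section Unimodal.
Variable R : realType.

Definition unimodal1 (nu : nat) : set (lpoly R) := [set f : lpoly R |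
  [/\ forall i : int, 0 <= f i,
      forall i : int, f (- i) = f i
    & forall r l : nat, (r < nu)%N ->
        f (r + l.+1 * nu)%N <= f (r + l * nu)%N]].

Definition strict_unimodal1 (nu : nat) : set (lpoly R) := [set f : lpoly R |
  unimodal1 nu f /\
  forall r l : nat, (r < nu)%N -> 0 < f (r + l * nu)%N ->
    f (r + l.+1 * nu)%N < f (r + l * nu)%N].

Definition unimodal2 (nu : nat) : set (lseries (lpoly R)) :=
  [set F | forall j : int, unimodal1 nu (F j)].

Definition strict_unimodal2 (nu : nat) : set (lseries (lpoly R)) :=
  [set F | forall j : int, strict_unimodal1 nu (F j)].

End Unimodal.

Arguments unimodal1 : clear implicits.
Arguments strict_unimodal1 : clear implicits.
Arguments unimodal2 : clear implicits.
Arguments strict_unimodal2 : clear implicits.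

(* The subtype structure requires val to be a semiring morphism into A, hence
   the semiring operations, 0 and 1 on S are those of the ambient ring A. *)
Definition forms_com_semiring (A : comPzRingType) (S : set A) : Prop :=
  inhabited (subComPzSemiRingType [in S]).

(* Main.v *)
(* Closure under products is the only substantial point. With h = f * g and the
   symmetry of f and g,
     2 (h_n - h_(n+nu)) = sum_t (f_(n-t) - f_(n+nu+t)) (g_t - g_(t+nu)).
   Since nu divides 2, the indices in each difference have absolute values
   congruent modulo nu, and for n >= 0 both differences have the sign of
   2t + nu, so every term is nonnegative. If moreover h_n > 0, then
   f_(n-t) g_t > 0 for some t, which may be taken nonnegative by replacing
   t with -t; strictness makes the term at t positive. *)
Require Import Defs.
From HB Require Import structures.
From mathcomp Require Import all_boot all_order all_algebra.
From mathcomp Require Import boolp classical_sets reals.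
From mathcomp Require Import fsbigop zify ring.

Set Implicit Arguments.
Unset Strict Implicit.
Unset Printing Implicit Defensive.
Import Order.TTheory GRing.Theory Num.Theory.
Local Open Scope classical_set_scope.
Local Open Scope ring_scope.

(** * Semirings from closed subsets, and the passage to series *)

Section SemiringOfClosedSet.
Variables (A : comPzRingType) (S : set A).
Hypothesis Sclosed : GRing.semiring_closed [in S].

Let T := {x : A | [in S] x}.
HB.instance Definition _ := SubChoice.on T.
HB.instance Definition _ :=
  GRing.SubChoice_isSubComPzSemiRing.Build A [in S] T Sclosed.

Lemma forms_com_semiring_closed : forms_com_semiring S.
Proof. exact: inhabits (T : subComPzSemiRingType [in S]). Qed.

End SemiringOfClosedSet.

(** Both series vanish below a common [- N], so each coefficient of a product is a finite sum of
    products of coefficients and stays in [S]. *)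
Lemma coefwise_semiring_closed (K : comNzRingType) (S : set K) :
  GRing.semiring_closed [in S] ->
  GRing.semiring_closed [in [set F : lseries K | forall j, S (F j)]].
Proof.
case=> -[S0 SD] [S1 SM]; split; split.
- by apply/mem_set => j; exact: set_mem S0.
- move=> F G /set_mem SF /set_mem SG; apply/mem_set => j.
  by apply: set_mem; apply: SD; exact: mem_set.
- apply/mem_set => j; rewrite lcoef1; apply: set_mem.
  by case: (j == 0).
- move=> F G /set_mem SF /set_mem SG; apply/mem_set => j.
  have [N [FN GN]] := lseries_below2 F G.
  change (S (lconv F G j)).
  rewrite (@lconv_window _ _ _ N (`|j| + N)) //; try lia.
  apply: set_mem; apply: (big_ind (fun x => x \in S)) => // k _.
  by apply: SM; exact: mem_set.
Qed.

(** * Products of symmetric Laurent polynomials *)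

Section LaurentPolynomials.
Variable R : realType.
Implicit Types f g : lpoly R.

Lemma pcoefD f g i : (f + g) i = f i + g i.
Proof. by []. Qed.

Lemma pcoef0 i : (0 : lpoly R) i = 0.
Proof. by []. Qed.

Lemma pcoef1 i : (1 : lpoly R) i = (i == 0)%:R.
Proof. exact: lcoef1. Qed.

Lemma pcoefM f g n : (f * g) n = \sum_(k \in [set: int]) f k * g (n - k).
Proof. by []. Qed.

Lemma pcoefM_reindex (s : int -> int) f g n : bijective s ->
  (f * g) n = \sum_(t \in [set: int]) f (n - s t) * g (s t).
Proof.
move=> [s' s'K sK]; rewrite pcoefM.
rewrite (@reindex_fsbig _ _ _ _ _ (fun t => n - s t) setT) /=.
  by apply: eq_fsbigr => t _; rewrite subKr.
split=> // [i j _ _|j _]; first by move=> ?; apply: (can_inj s'K); lia.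
by exists (s' (n - j)) => //; rewrite sK subKr.
Qed.

(** Symmetry turns the lower bound on the exponents of a Laurent series into a two-sided one. *)
Lemma pcoef_sym_bounded g : (forall i, g (- i) = g i) ->
  exists N : nat, forall i : int, (N%:Z < `|i|) -> g i = 0.
Proof.
move=> gsym; have [N gN] := lseries_below (val g).
exists N => i iN; case: (ltP i 0) => i0; first by apply: gN; lia.
by rewrite -gsym; apply: gN; lia.
Qed.

(* Symmetrization of sum_t f (n - t) * (g t - g (t + d)) under t -> - d - t. *)
Lemma pcoefM_drop f g (n d : int) :
    (forall i, f (- i) = f i) -> (forall i, g (- i) = g i) ->
  exists M0 : nat, forall M, (M0 <= M)%N ->
  2 * ((f * g) n - (f * g) (n + d)) =
  \sum_(t <- window M) (f (n - t) - f (n + d + t)) * (g t - g (t + d)).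
Proof.
move=> fsym gsym; have [N gN] := pcoef_sym_bounded gsym.
(* Outside such a window both [g t] and [g (t + d)] vanish. [M] stays free so that the window can be
   enlarged to contain a given index. *)
exists (N + `|d|)%N => M leM.
(* [E1] to [E4] are the four terms of the expanded product of differences; the symmetry of [g]
   enters in [E2] and [E4]. *)
have E1 : (f * g) n = \sum_(t <- window M) f (n - t) * g t.
  rewrite (@pcoefM_reindex id) ?(@fsum_window _ _ M) //; last by exists id.
  by move=> j jM; rewrite gN ?mulr0 //; lia.
have E2 : (f * g) n = \sum_(t <- window M) f (n + d + t) * g (t + d).
  rewrite (@pcoefM_reindex (fun t => - (t + d))); last first.
    by exists (fun t => - t - d) => t; lia.
  rewrite (@fsum_window _ _ M); last first.
    by move=> j jM; rewrite gN ?mulr0 //; lia.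
  by apply: eq_bigr => t _; rewrite gsym opprK [t + d]addrC addrA.
have E3 : (f * g) (n + d) = \sum_(t <- window M) f (n - t) * g (t + d).
  rewrite (@pcoefM_reindex (fun t => t + d)); last first.
    by exists (fun t => t - d) => t; lia.
  rewrite (@fsum_window _ _ M); last first.
    by move=> j jM; rewrite gN ?mulr0 //; lia.
  by apply: eq_bigr => t _; congr (f _ * _); lia.
have E4 : (f * g) (n + d) = \sum_(t <- window M) f (n + d + t) * g t.
  rewrite (@pcoefM_reindex (fun t => - t)); last by exists -%R => t; lia.
  rewrite (@fsum_window _ _ M); last first.
    by move=> j jM; rewrite gN ?mulr0 //; lia.
  by apply: eq_bigr => t _; rewrite gsym opprK.
rewrite mulr_natl mulr2n {1}E1 {1}E3 E2 E4 -!sumrB -big_split.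
by apply: eq_bigr => t _ /=; ring.
Qed.

(** * Unimodality of products *)

Section UnimodalProduct.
Variable nu : nat.
Hypothesis hnu : nu = 1%N \/ nu = 2%N.

Lemma unimodal1_abs f (i : int) : unimodal1 R nu f -> f i = f `|i|%N.
Proof.
by case=> _ fsym _; have [i0|i0] := ltP i 0; [rewrite -fsym|];
  congr (f _); lia.
Qed.

(** Euclidean division by [nu] puts every index in the form [r + l * nu], so that residues no longer
    have to be tracked. *)
Lemma residue_step (P : nat -> nat -> Prop) :
    (forall r l, (r < nu)%N -> P (r + l * nu)%N (r + l.+1 * nu)%N) ->
  forall i, P i (i + nu)%N.
Proof.
move=> Pr i; have nu0 : (0 < nu)%N by case: hnu => ->.
have := Pr (i %% nu)%N (i %/ nu)%N (ltn_pmod _ nu0).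
by rewrite mulSnr addnA [(_ %% _ + _)%N]addnC -divn_eq.
Qed.

Lemma unimodal1_le f (a b : int) : unimodal1 R nu f ->
  (`|a| <= `|b|)%N -> (nu %| `|b| - `|a|)%N -> f b <= f a.
Proof.
move=> fU leab /dvdnP[m mE]; have [_ _ fdec] := fU.
rewrite (unimodal1_abs a fU) (unimodal1_abs b fU) -(subnKC leab) mE.
elim: m {mE} => [|m IHm]; first by rewrite mul0n addn0.
apply: le_trans IHm; rewrite mulSnr addnA.
exact: (residue_step (P := fun i j => f j <= f i)).
Qed.

(** The first step, from |a| to |a| + nu, is strict because [f a] is positive; the remaining steps
    up to |b| may be weak. *)
Lemma strict_unimodal1_lt f (a b : int) : strict_unimodal1 R nu f ->
  (`|a| < `|b|)%N -> (nu %| `|b| - `|a|)%N -> 0 < f a -> f b < f a.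
Proof.
move=> [fU fdec] ltab dvdab; rewrite (unimodal1_abs a fU) => fa0.
have leab : (nu <= `|b| - `|a|)%N by apply: dvdn_leq => //; lia.
apply: (@le_lt_trans _ _ (f (`|a| + nu)%N)).
  apply: unimodal1_le => //; first by lia.
  by rewrite !absz_nat subnDA dvdn_subl.
exact: (residue_step (P := fun i j => 0 < f i -> f j < f i)).
Qed.

(** Since (n + nu + t)^2 - (n - t)^2 = (2n + nu)(2t + nu) and (t + nu)^2 - t^2 = nu (2t + nu), the
    sign of 2t + nu decides both comparisons of absolute values. *)
Lemma unimodal1_product_term f g (n : nat) (t : int) :
    unimodal1 R nu f -> unimodal1 R nu g ->
  0 <= (f (n%:Z - t) - f (n%:Z + nu%:Z + t)) * (g t - g (t + nu%:Z)).
Proof.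
move=> fU gU; have [t0|t0] := leP 0 (t + t + nu%:Z).
  by apply: mulr_ge0; rewrite subr_ge0; apply: unimodal1_le => //;
    case: hnu t0 => ->; lia.
by apply: mulr_le0; rewrite subr_le0; apply: unimodal1_le => //;
  case: hnu t0 => ->; lia.
Qed.

Lemma unimodal1M f g :
  unimodal1 R nu f -> unimodal1 R nu g -> unimodal1 R nu (f * g).
Proof.
move=> fU gU; have [f0 fsym _] := fU; have [g0 gsym _] := gU; split=> [i|i|r l rnu].
- by rewrite pcoefM; apply: fsumr_ge0 => k _; apply: mulr_ge0.
- rewrite (@pcoefM_reindex -%R); last by exists -%R => t; lia.
  rewrite [RHS](@pcoefM_reindex id); last by exists id.
  by apply: eq_fsbigr => t _; rewrite gsym -opprD fsym.
- have [M /(_ M (leqnn M)) fgE] := pcoefM_drop (r + l * nu)%N nu fsym gsym.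
  rewrite mulSnr addnA PoszD -subr_ge0 -(pmulr_rge0 _ (ltr0n _ 2)) fgE.
  by apply: sumr_ge0 => t _; exact: unimodal1_product_term.
Qed.

Lemma strict_unimodal1M f g :
  strict_unimodal1 R nu f -> strict_unimodal1 R nu g ->
  strict_unimodal1 R nu (f * g).
Proof.
move=> fT gT; have [fU _] := fT; have [gU _] := gT.
have [f0 fsym _] := fU; have [g0 gsym _] := gU; split; first exact: unimodal1M.
move=> r l rnu; rewrite mulSnr addnA PoszD; set n := (r + l * nu)%N => fg0.
have [t ft0 gt0] : exists2 t : int, 0 < f (n%:Z - t) & 0 < g t.
  (* Otherwise nonnegativity would make every term of the convolution at [n] zero. *)
  apply: contrapT => no; move: fg0.
  rewrite (@pcoefM_reindex id); last by exists id.
  rewrite fsbig1 ?ltxx // => t _; apply/eqP; rewrite mulf_eq0.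
  have := f0 (n%:Z - t); have := g0 t; rewrite !le_eqVlt.
  move=> /orP[/eqP<-|gt0]; first by rewrite eqxx orbT.
  move=> /orP[/eqP<-|ft0]; first by rewrite eqxx.
  by case: no; exists t.
wlog t0 : t ft0 gt0 / 0 <= t => [th|].
  have [/th|t0] := leP 0 t; first exact.
  apply: (th (- t)); rewrite ?gsym //; last by lia.
  (* For t < 0 <= n, |n + t| <= |n - t| and both have the same parity, hence f (n + t) >= f (n -
     t). *)
  apply: lt_le_trans ft0 _; apply: unimodal1_le => //; first by lia.
  by case: hnu => ->; lia.
have [M0 fgE] := pcoefM_drop n nu fsym gsym.
(* The summand [|t|] in the window size ensures that [t] lies in the window and its term can be
   split off. *)
rewrite -subr_gt0 -(pmulr_rgt0 _ (ltr0n _ 2)) (fgE (M0 + `|t|)%N) ?leq_addr //.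
rewrite (bigD1_seq t) ?window_uniq ?mem_window //=; last by lia.
apply: ltr_pwDl; last by apply: sumr_ge0 => ? _; exact: unimodal1_product_term.
by apply: mulr_gt0; rewrite subr_gt0; apply: strict_unimodal1_lt => //;
  case: hnu => nuE; rewrite ?nuE; lia.
Qed.

Lemma unimodal1_semiring_closed : GRing.semiring_closed [in unimodal1 R nu].
Proof.
split; split.
- by apply/mem_set; split.
- move=> f g /set_mem[f0 fsym fdec] /set_mem[g0 gsym gdec]; apply/mem_set.
  split=> [i|i|r l rnu]; rewrite !pcoefD; first exact: addr_ge0.
    by rewrite fsym gsym.
  by apply: lerD; [exact: fdec|exact: gdec].
- apply/mem_set; split=> [i|i|r l rnu]; rewrite !pcoef1 ?oppr_eq0 //.
  (* The index r + (l + 1) nu is positive, so the unit has coefficient 0 there. *)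
  by rewrite ler_nat; case: hnu => ->; lia.
- by move=> f g /set_mem fU /set_mem gU; apply/mem_set; exact: unimodal1M.
Qed.

Lemma strict_unimodal1_semiring_closed :
  GRing.semiring_closed [in strict_unimodal1 R nu].
Proof.
have [[U0 UD] [U1 _]] := unimodal1_semiring_closed; split; split.
- by apply/mem_set; split=> [|r l _]; [exact: set_mem U0|rewrite pcoef0 ltxx].
- move=> f g /set_mem[fU fT] /set_mem[gU gT]; apply/mem_set; split.
    by apply: set_mem; apply: UD; exact: mem_set.
  move=> r l rnu; rewrite !pcoefD => fg0.
  have [f0 _ fdec] := fU; have [g0 _ gdec] := gU.
  (* A positive sum has at least one positive summand, and a strict drop in that one suffices. *)
  have := f0 (r + l * nu)%N; rewrite le_eqVlt => /orP[/eqP fE|fpos].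
    apply: ler_ltD; first exact: fdec.
    by apply: gT => //; rewrite -fE add0r in fg0.
  by apply: ltr_leD; [exact: fT|exact: gdec].
- apply/mem_set; split=> [|r l rnu]; first exact: set_mem U1.
  by rewrite !pcoef1 ltr0n ltr_nat; case: hnu => ->; lia.
- by move=> f g /set_mem fT /set_mem gT; apply/mem_set; exact: strict_unimodal1M.
Qed.

End UnimodalProduct.
End LaurentPolynomials.

Local Close Scope ring_scope.
Local Close Scope classical_set_scope.

Theorem theorem1p5 (R : realType) (nu : nat) (hnu : nu = 1 \/ nu = 2) :
  forms_com_semiring (unimodal2 R nu) /\
  forms_com_semiring (strict_unimodal2 R nu).
Proof.
split; apply: forms_com_semiring_closed.
  exact: coefwise_semiring_closed (unimodal1_semiring_closed R hnu).
exact: coefwise_semiring_closed (strict_unimodal1_semiring_closed R hnu).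
Qed.
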